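(* Let $\lambda>0$, let $\Omega\subseteq\mathbb{R}^d$, and let $\phi:\Omega\to\mathbb{R}^n$ be continuous (and smooth enough for the first and second derivatives written below to make sense). Let $\bar y\in\mathbb{R}^n$ and suppose that there are a neighbourhood $U$ of $\bar y$ and $k\in\mathbb{N}$ such that for all $y'\in U$ there exist $\beta_{y'}\in\mathbb{R}^k$ and $\mathcal{X}_{y'}\in\Omega^k$ such that the discrete measure $\mathbf{m}_{\beta_{y'},\mathcal{X}_{y'}}$ solves the Blasso problem $\mathcal{P}_\lambda(y')$. Assume also that the mapping $y\in U\mapsto(\beta_y,\mathcal{X}_y)\in\mathbb{R}^k\times\Omega^k$ is differentiable. Write $\bar{\mathcal{X}}=(\bar x_j)_{j=1}^k=\mathcal{X}_{\bar y}$ and $\bar\beta=\beta_{\bar y}$ (with non-zero entries $\bar\beta_j$), and let $Q=(Q_j)_{j=1}^k$ with $Q_j=-\frac{\lambda}{\bar\beta_j}\nabla^2\eta_{\bar y}(\bar x_j)\in\mathbb{R}^{d\times d}$. Assume that $$M=\Gamma_{\bar{\mathcal{X}}}^*\Gamma_{\bar{\mathcal{X}}}+\begin{pmatrix}0_{k\times k}&0_{k\times kd}\\0_{kd\times k}&\mathrm{diag}(Q)\end{pmatrix}$$ is invertible, where $\mathrm{diag}(Q)$ is the block-diagonal matrix with the blocks $(Q_j)_j$ along the diagonal. Then the estimator $\hat\mu(y)=\Phi\mathbf{m}_y$ (where $\mathbf{m}_y$ is any solution of $\mathcal{P}_\lambda(y)$) satisfies $$\mathrm{div}(\hat\mu)(\bar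 y)=\mathrm{tr}\left(\Gamma_{\bar{\mathcal{X}}}M^{-1}\Gamma_{\bar{\mathcal{X}}}^*\right).$$
   Context: $\mathcal{M}(\Omega)$ is the space of Radon measures on $\Omega$ and $|\mathbf{m}|_{TV}=|\mathbf{m}|(\Omega)$ is the total variation norm. Define $\Phi:\mathcal{M}(\Omega)\to\mathbb{R}^n$ by $\Phi\mathbf{m}=\int_\Omega\phi(x)\,d\mathbf{m}(x)$ and, for $p\in\mathbb{R}^n$, $(\Phi^*p)(x)=\langle\phi(x),p\rangle$. The Blasso problem $\mathcal{P}_\lambda(y)$ is $$\min_{\mathbf{m}\in\mathcal{M}(\Omega)}\ \tfrac12\|\Phi\mathbf{m}-y\|_2^2+\lambda|\mathbf{m}|_{TV}.$$ The value $\hat\mu(y)=\Phi\mathbf{m}_y$ does not depend on the choice of the solution $\mathbf{m}_y$. The dual certificate is $\eta_y=\Phi^*\big(\tfrac{y-\Phi\mathbf{m}_y}{\lambda}\big)$, which is also independent of the chosen solution. For $\beta\in\mathbb{R}^k$ and $\mathcal{X}=(x_j)_{j=1}^k\in\Omega^k$, $\mathbf{m}_{\beta,\mathcal{X}}=\sum_{j=1}^k\beta_j\delta_{x_j}$. The matrix $\Phi_{\mathcal{X}}\in\mathbb{R}^{n\times k}$ is defined by $\Phi_{\mathcal{X}}\beta=\sum_j\beta_j\phi(x_j)$. The matrix $\Phi_{\mathcal{X}}^{(1)}\in\mathbb{R}^{n\times kd}$ is defined, for $b=(b_j)_{j=1}^k$ with $b_j\in\mathbb{R}^d$, by $\Phi^{(1)}_{\mathcal{X}}b=\sum_{j=1}^kJ_\phi(x_j)b_j$,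 where $J_\phi(x)\in\mathbb{R}^{n\times d}$ is the Jacobian of $\phi$. Finally $\Gamma_{\mathcal{X}}=[\Phi_{\mathcal{X}},\Phi^{(1)}_{\mathcal{X}}]\in\mathbb{R}^{n\times k(d+1)}$. For $\hat\mu:\mathbb{R}^n\to\mathbb{R}^n$, $\mathrm{div}(\hat\mu)(y)=\sum_{i=1}^n\frac{\partial\hat\mu_i}{\partial y_i}(y)$.
   Formalization: The points x̄_j are assumed to lie in the interior of Ω; for boundary points the formula can fail (Ω=[0,1], φ(x)=(1,x), λ=1, ȳ=(2,3): the divergence is 1 but the trace is 2). *)

(* Defs.v *)
From HB Require Import structures.
From mathcomp Require Import all_boot all_order all_algebra.
From mathcomp Require Import all_classical all_reals all_analysis.

Set Implicit Arguments.
Unset Strict Implicit.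
Unset Printing Implicit Defensive.

Import Order.TTheory GRing.Theory Num.Theory.
Import numFieldNormedType.Exports.

Local Open Scope classical_set_scope.
Local Open Scope ring_scope.

(* R^d is 'rV[R]_d throughout; borelRV R d is the same type, equipped with the
   Borel sigma-algebra. *)
Notation borelRV R d := (g_sigma_algebraType (@open 'rV[R]_d)).

(* The Jordan parts do not depend on the chosen Hahn decomposition
   (Hahn_decomposition_uniq). *)
Section hahn_jordan.
Context dsp (T : measurableType dsp) (R : realType).
Variable m : {charge set T -> \bar R}.

Lemma hahn_ex : exists PN : set T * set T, hahn_decomposition m PN.1 PN.2.
Proof. by have [P [N PN]] := Hahn_decomposition m; exists (P, N). Qed.

Definition hahn := projT2 (cid hahn_ex).

Definition pos_part : {finite_measure set T -> \bar R} := jordan_pos hahn.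
Definition neg_part : {finite_measure set T -> \bar R} := jordan_neg hahn.
Definition variation : {measure set T -> \bar R} := charge_variation hahn.

Definition tv_norm : R := fine (variation setT).

End hahn_jordan.

(* M(Omega): a finite signed Radon measure on Omega is encoded by its extension
   by zero to R^d. Since finite Borel measures on R^d are regular, inner
   regularity by compact subsets of Omega amounts to the condition below, which
   makes sense for any Omega (for Omega Borel, it says that the variation
   of the complement of Omega is 0). *)
Definition radon (R : realType) (d : nat) (Omega : set 'rV[R]_d)
    (m : {charge set (borelRV R d) -> \bar R}) : Prop :=
  forall e : R, 0 < e -> exists K : set 'rV[R]_d,
    [/\ compact K, K `<=` Omega & (variation m (~` K) < e%:E)%E].

Section blasso.
Context (R : realType) (d n : nat).
Variables (Omega : set 'rV[R]_d) (phi : 'rV[R]_d -> 'rV[R]_n).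
Implicit Types (m : {charge set (borelRV R d) -> \bar R}) (y p : 'rV[R]_n).

(* The domain of Phi: phi may be unbounded when Omega is not compact. If phi is
   bounded on Omega, this is all of M(Omega). *)
Definition Phi_dom m : Prop :=
  radon Omega m /\
  forall i : 'I_n,
    (variation m).-integrable Omega (fun x => (phi x 0 i)%:E).

(* Omega need not be measurable. A Radon measure on Omega is concentrated on a
   sigma-compact subset S of Omega, and the library integral of a nonnegative
   function over Omega (a supremum over simple functions below it, extended by
   zero) then equals its integral over S. *)
Definition Phi m : 'rV[R]_n :=
  \row_i (\int[pos_part m]_(x in Omega) phi x 0 i
          - \int[neg_part m]_(x in Omega) phi x 0 i).

Definition Phi_adj p (x : 'rV[R]_d) : R := \sum_i phi x 0 i * p 0 i.

Definition blasso_obj (lam : R) y m : R :=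
  2^-1 * (\sum_i ((Phi m - y) 0 i) ^+ 2) + lam * tv_norm m.

Definition blasso_solution (lam : R) y m : Prop :=
  Phi_dom m /\
  forall m', Phi_dom m' -> blasso_obj lam y m <= blasso_obj lam y m'.

(* eta_y, computed from the solution m of the problem at y *)
Definition dual_cert (lam : R) y m : 'rV[R]_d -> R :=
  Phi_adj (lam^-1 *: (y - Phi m)).

End blasso.

(* sum_j beta_j delta_(x_j), where x_j is the j-th row of X *)
Section discrete_measure.
Context (R : realType) (d k : nat).
Variables (beta : 'rV[R]_k) (X : 'M[R]_(k, d)).

Definition discrete_measure (A : set (borelRV R d)) : \bar R :=
  (\sum_(j < k) (beta 0 j)%:E * \d_(row j X : borelRV R d) A)%E.

Let discrete_charge :
  exists m : {charge set (borelRV R d) -> \bar R}, discrete_measure = m.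
Proof.
suff [m mE] : exists m : {charge set (borelRV R d) -> \bar R},
  forall A, (\sum_(j < k) (beta 0 j)%:E * \d_(row j X : borelRV R d) A)%E = m A.
  by exists m; apply/funext.
elim: (index_enum _) => [|j r [m IH]].
  by exists czero => A; rewrite big_nil.
exists (cadd (cscale (beta 0 j)
  (charge_of_finite_measure (\d_(row j X : borelRV R d)))) m) => A.
by rewrite big_cons IH.
Qed.

Let discrete0 : discrete_measure set0 = 0%E.
Proof. by have [m ->] := discrete_charge; exact: charge0. Qed.

Let discrete_fin A : measurable A -> discrete_measure A \is a fin_num.
Proof. by have [m ->] := discrete_charge; exact: fin_num_measure. Qed.

Let discrete_sigma : semi_sigma_additive discrete_measure.
Proof.
by have [m ->] := discrete_charge; exact: charge_semi_sigma_additive.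
Qed.

HB.instance Definition _ := isCharge.Build _ _ R discrete_measure
  discrete0 discrete_fin discrete_sigma.

End discrete_measure.

Section Gamma_matrix.
Context (R : realType) (d n k : nat).
Variables (phi : 'rV[R]_d -> 'rV[R]_n) (X : 'M[R]_(k, d)).

Definition Phi_mx : 'M[R]_(n, k) := \matrix_(i, j) phi (row j X) 0 i.

(* The library's Jacobian acts on row vectors from the right; its transpose is
   the usual n x d matrix. *)
Definition Phi1_mx : 'M[R]_(n, \sum_(j < k) d) :=
  \mxrow_(j < k) (jacobian phi (row j X))^T.

Definition Gamma_mx : 'M[R]_(n, k + \sum_(j < k) d) := row_mx Phi_mx Phi1_mx.

End Gamma_matrix.

Definition hessian (R : realType) (d : nat) (f : 'rV[R]_d -> R)
    (x : 'rV[R]_d) : 'M[R]_d :=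
  \matrix_(a, b) 'D_(delta_mx 0 b) (fun z => 'D_(delta_mx 0 a) f z) x.

Definition M_mx (R : realType) (d n k : nat) (G : 'M[R]_(n, k + \sum_(j < k) d))
    (Q : 'I_k -> 'M[R]_d) : 'M[R]_(k + \sum_(j < k) d) :=
  G^T *m G + block_mx 0 0 0 (\mxdiag_(j < k) Q j).

(* The library's directional derivative 'D_v is total, so the existence of the
   partial derivatives occurring in the divergence is a separate predicate. *)
Definition has_partials (R : realType) (n : nat) (f : 'rV[R]_n -> 'rV[R]_n)
    (y : 'rV[R]_n) : Prop :=
  forall i : 'I_n, derivable (fun z => f z 0 i) y (delta_mx 0 i).

Definition divergence (R : realType) (n : nat) (f : 'rV[R]_n -> 'rV[R]_n)
    (y : 'rV[R]_n) : R :=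
  \sum_i 'D_(delta_mx 0 i) (fun z => f z 0 i) y.

(* Main.v *)
(**
Write [p y = y - Phi m_y], so that [eta_y = Phi^* (p y) / lam]. Moving from the
discrete solution towards an arbitrary discrete measure on [Omega] gives
[|Phi^* (p y)| <= lam] on [Omega] and [lam |m_y| <= <Phi m_y, p y>]. Integrating
the first bound against any other solution and using strict convexity of the
squared norm shows that [Phi m_y] does not depend on the solution, hence
[muhat y = sum_j beta_j phi (x_j)] near [ybar].

Invertibility of [M] forces the positions at [ybar], hence nearby, to be
distinct, and then [<phi (x_j), p> = lam sgn (beta_j)]. So [Phi^* p] has an
interior extremum at each [x_j], and [J_phi (x_j)^T p = 0]. Differentiating
these two systems at [ybar] in a direction [v], with
[w = (d beta_j, beta_j d x_j)_j] and [d p = v - G w], yields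
[G^T (v - G w) = diag (0, Q) w], that is [M w = G^T v], and therefore
[d muhat = G w = G M^-1 G^T v].
*)

Require Import Defs.
From HB Require Import structures.
From mathcomp Require Import all_boot all_order all_algebra.
From mathcomp Require Import all_classical all_reals all_analysis.
From mathcomp Require Import measurable_realfun ring lra.

Set Implicit Arguments.
Unset Strict Implicit.
Unset Printing Implicit Defensive.

Import Order.TTheory GRing.Theory Num.Theory.
Import numFieldNormedType.Exports.

Local Open Scope classical_set_scope.
Local Open Scope ring_scope.

(* realfun also defines a [variation]. *)
Local Notation variation := Defs.variation.

(** * Total variation of a charge via its Hahn decomposition *)

Section charge_tv.
Context dsp (T : measurableType dsp) (R : realType).
Implicit Type m : {charge set T -> \bar R}.

(** The two Hahn sets cover the space and are disjoint, so the negative one is the complement of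
    [P]; both Jordan parts can then be read off from [m] and a single set. *)
Lemma hahn_partsE m : exists2 P, measurable P & forall A, measurable A ->
  pos_part m A = m (A `&` P) /\ neg_part m A = (- m (A `&` ~` P))%E.
Proof.
have [[mP _] [mN _] PUN PIN] := hahn m.
set P := (projT1 (cid (hahn_ex m))).1 in mP PUN PIN *.
set N := (projT1 (cid (hahn_ex m))).2 in mN PUN PIN *.
have NE : ~` P = N.
  apply/seteqP; split => x /=.
    move=> nPx; have : (P `|` N) x by rewrite PUN.
    by case.
  move=> Nx Px; suff : (P `&` N) x by rewrite PIN.
  by split.
exists P => // A mA; split.
  by rewrite /pos_part /= jordan_posE cjordan_posE /crestr0 mem_set.
by rewrite NE /neg_part /= jordan_negE cjordan_negE /crestr0 mem_set.
Qed.

Lemma tv_normE m : tv_norm m = fine (pos_part m setT) + fine (neg_part m setT).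
Proof. by rewrite /tv_norm -fineD// fin_num_measure. Qed.

Lemma tv_norm_attained m : exists2 P, measurable P &
  tv_norm m = fine (m P) - fine (m (~` P)).
Proof.
have [P mP PE] := hahn_partsE m; exists P => //; rewrite tv_normE.
by have [-> ->] := PE _ measurableT; rewrite !setTI fineN.
Qed.

Lemma pos_neg_partE m A : measurable A ->
  fine (m A) = fine (pos_part m A) - fine (neg_part m A).
Proof.
move=> mA; rewrite (jordan_decomp (hahn m) mA) /cadd/= cscaleN1.
by rewrite -fineN -fineD// ?fin_numN fin_num_measure.
Qed.

Lemma fine_le_measureT (mu : {finite_measure set T -> \bar R}) A :
  measurable A -> 0 <= fine (mu A) <= fine (mu setT).
Proof.
move=> mA; rewrite fine_ge0//= fine_le ?fin_num_measure//.
by rewrite le_measure ?inE.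
Qed.

Lemma le_tv_norm m A : measurable A ->
  fine (m A) - fine (m (~` A)) <= tv_norm m.
Proof.
move=> mA; have mAc := measurableC mA.
rewrite (pos_neg_partE m mA) (pos_neg_partE m mAc) tv_normE.
have /andP[_ posA] := fine_le_measureT (pos_part m) mA.
have /andP[negA _] := fine_le_measureT (neg_part m) mA.
have /andP[posAc _] := fine_le_measureT (pos_part m) mAc.
have /andP[_ negAc] := fine_le_measureT (neg_part m) mAc.
rewrite opprB lerD//.
  by apply: le_trans posA; rewrite lerBlDr lerDl.
by apply: le_trans negAc; rewrite lerBlDr lerDl.
Qed.

End charge_tv.

(** * Integrals over a set that need not be measurable *)

Section integral_concentrated.
Context dsp (T : measurableType dsp) (R : realType).
Variable mu : {measure set T -> \bar R}.
Local Open Scope ereal_scope.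
Import HBNNSimple.

(** Since [D] may fail to be measurable, the argument goes back to the supremum over simple
    functions, for the positive and negative parts of [f] separately. Cutting a simple function down
    to [S] does not change its integral, as the complement of [S] is null; conversely, a simple
    function below the restriction to [S] is below the restriction to [D]. *)
Lemma integral_concentrated (D S : set T) (f : T -> \bar R) :
  measurable S -> S `<=` D -> mu (~` S) = 0 ->
  \int[mu]_(x in D) f x = \int[mu]_(x in S) f x.
Proof.
move=> mS SD muS.
suff H (g : T -> \bar R) : (forall x, D x -> 0 <= g x) ->
    \int[mu]_(x in D) g x = \int[mu]_(x in S) g x.
  rewrite integralE [RHS]integralE H// H//.
move=> g0.
have g0S x : S x -> 0 <= g x by move=> /SD/g0.
rewrite !ge0_integralE//; apply/eqP; rewrite eq_le; apply/andP; split.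
  apply: ge_ereal_sup => _ [h /= hg <-]; apply: le_ereal_sup_tmp.
  exists (sintegral mu (proj_nnsfun h mS)).
    exists (proj_nnsfun h mS) => // x; rewrite -mrestrict /patch.
    case: ifPn => // /[!inE] Sx; have := hg x.
    by rewrite /patch mem_set//; exact: SD.
  rewrite -mrestrict -integral_nnsfun// -[in leLHS](patch_setT (0%R) h).
  rewrite -integral_nnsfun//.
  rewrite (ge0_negligible_integral (measurableC mS))//.
  - by rewrite setTD setCK.
  - exact/measurable_EFinP.
  - by move=> x _; rewrite lee_fin fun_ge0.
apply: ereal_sup_le => _ [h /= hg <-]; exists h => // x.
apply: le_trans (hg x) _; rewrite /patch.
case: ifPn => [/[!inE] Sx|_]; first by rewrite mem_set//; exact: SD.
by case: ifPn => // xD; apply: g0; rewrite inE in xD.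
Qed.
End integral_concentrated.

(** * Borel sets and measurability of continuous functions *)

Section borel.
Context (R : realType) (d : nat).

Lemma borel_open (A : set 'rV[R]_d) : open A ->
  measurable (A : set (borelRV R d)).
Proof. by move=> oA; apply: sub_sigma_algebra. Qed.

Lemma borel_closed (A : set 'rV[R]_d) : closed A ->
  measurable (A : set (borelRV R d)).
Proof.
move=> cA; rewrite -(setCK A); apply: measurableC; apply: borel_open.
exact: closed_openC.
Qed.

Lemma borel_compact (A : set 'rV[R]_d) : compact A ->
  measurable (A : set (borelRV R d)).
Proof.
by move=> cA; apply: borel_closed; apply: compact_closed.
Qed.

(** Open intervals generate the Borel sets of the line, and their preimages within [D] are traces on
    [D] of open sets. *)
Lemma within_continuous_measurable (D : set 'rV[R]_d) (f : 'rV[R]_d -> R) :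
  measurable (D : set (borelRV R d)) -> {within D, continuous f} ->
  measurable_fun (D : set (borelRV R d)) (f : borelRV R d -> R).
Proof.
move=> mD fD.
apply: (measurability _ (RGenOpens.measurableE R)) => // _ [_ [a [b ->] <-]].
have : open (f @^-1` `]a, b[%classic : set (subspace D)).
  by move/continuousP : fD; apply; exact: interval_open.
move=> /open_subspaceP[V oV VE]; rewrite setIC -VE.
by apply: measurableI => //; exact: borel_open.
Qed.

End borel.

(** * Radon measures are concentrated on sigma-compact sets *)

Section concentration.
Context (R : realType) (d : nat) (Omega : set 'rV[R]_d).
Implicit Type m : {charge set (borelRV R d) -> \bar R}.

Lemma pos_neg_part_concentrated m (S : set (borelRV R d)) :
  measurable S -> variation m (~` S) = 0%E ->
  pos_part m (~` S) = 0%E /\ neg_part m (~` S) = 0%E.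
Proof.
move=> mS; rewrite /variation /= /charge_variation /=.
by move=> /eqP; rewrite padde_eq0 ?measure_ge0// => /andP[/eqP-> /eqP->].
Qed.

(** [S] is the union of compact sets [K i] whose complements have variation below [1 / (i + 1)]. It
    is a measurable substitute for [Omega]. *)
Lemma radon_concentrated m : radon Omega m ->
  exists S : set (borelRV R d), [/\ measurable S, S `<=` Omega,
    pos_part m (~` S) = 0%E & neg_part m (~` S) = 0%E].
Proof.
move=> rm.
have [K KP] : exists K : nat -> set 'rV[R]_d, forall i,
    [/\ compact (K i), K i `<=` Omega &
        (variation m (~` K i) < (i.+1%:R^-1)%:E)%E].
  have /choice[K KP] : forall i : nat, exists K : set 'rV[R]_d,
      [/\ compact K, K `<=` Omega & (variation m (~` K) < (i.+1%:R^-1)%:E)%E].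
    by move=> i; apply: rm; rewrite invr_gt0 ltr0n.
  by exists K.
pose S : set (borelRV R d) := \bigcup_i K i.
have mK i : measurable (K i : set (borelRV R d)).
  by have [cK _ _] := KP i; exact: borel_compact.
have mS : measurable S by exact: bigcupT_measurable.
have vS : variation m (~` S) = 0%E.
  apply/eqP; rewrite eq_le measure_ge0 andbT.
  apply/lee_addgt0Pr => e e0; rewrite add0e.
  have [i _ ie] : \forall i \near \oo, (i.+1%:R^-1 < e :> R).
    exact: near_infty_natSinv_lt (PosNum e0).
  have [_ _ /ltW Ki] := KP i.
  apply: (@le_trans _ _ (variation m (~` K i))).
    apply: le_measure; rewrite ?inE.
    - exact: measurableC mS.
    - exact: measurableC (mK i).
    - by apply: subsetC; exact: bigcup_sup.
  by apply: (le_trans Ki); rewrite lee_fin ltW//; exact: (ie i (leqnn i)).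
have [pS nS] := pos_neg_part_concentrated mS vS.
by exists S; split => // x [i _] Kx; have [_ + _] := KP i; apply.
Qed.

End concentration.

(** * Comparison, summation and bounds for integrals *)

Section integral_extra.
Context dsp (T : measurableType dsp) (R : realType).

Lemma le_measure_integral_abs (mu nu : {measure set T -> \bar R}) (D : set T)
    (f : T -> \bar R) :
  (forall A, measurable A -> (mu A <= nu A)%E) -> measurable D ->
  measurable_fun D f ->
  (\int[mu]_(x in D) `|f x| <= \int[nu]_(x in D) `|f x|)%E.
Proof.
move=> munu mD mf; rewrite integral_mkcond [leRHS]integral_mkcond.
apply: ge0_le_measure_integral => //; first exact: erestrict_ge0.
by apply/(measurable_restrictT _ mD); exact: measurableT_comp.
Qed.

Lemma Rintegral_sum (mu : {measure set T -> \bar R}) (D : set T) n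
    (f : 'I_n -> T -> R) : measurable D ->
  (forall i, mu.-integrable D (EFin \o f i)) ->
  \int[mu]_(x in D) (\sum_i f i x) = \sum_i \int[mu]_(x in D) f i x.
Proof.
move=> mD intf; rewrite /Rintegral.
under eq_integral do rewrite -sumEFin.
rewrite integral_sum// -sum_fine// => i _.
exact (integrable_fin_num mD (intf i)).
Qed.

Lemma normr_Rintegral_le (mu : {finite_measure set T -> \bar R}) (D : set T)
    (f : T -> R) (c : R) : measurable D -> mu.-integrable D (EFin \o f) ->
  (forall x, D x -> `|f x| <= c) -> 0 <= c ->
  `|\int[mu]_(x in D) f x| <= c * fine (mu setT).
Proof.
move=> mD intf fc c0; apply: le_trans (le_normr_Rintegral mD intf) _.
apply: (@le_trans _ _ (\int[mu]_(x in D) c)).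
  apply: le_Rintegral => //; first exact: integrable_norm.
  exact: finite_measure_integrable_cst.
rewrite Rintegral_cst// ler_wpM2l//.
by have /andP[] := fine_le_measureT mu mD.
Qed.

End integral_extra.

(** * Duality bound for the pairing with [Phi m] *)

Section Phi_bound.
Context (R : realType) (d n : nat).
Variables (Omega : set 'rV[R]_d) (phi : 'rV[R]_d -> 'rV[R]_n).
Hypothesis hphi : {within Omega, continuous phi}.
Implicit Types m : {charge set (borelRV R d) -> \bar R}.

Lemma coord_measurable (S : set (borelRV R d)) i : measurable S ->
  S `<=` Omega -> measurable_fun S (EFin \o (fun x => phi x 0 i)).
Proof.
move=> mS SO; apply/measurable_EFinP.
apply: (within_continuous_measurable mS).
apply: (@continuous_subspaceW 'rV[R]_d R _ _ _ SO).
apply: (@within_continuous_comp _ _ _ Omega phi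
  (fun v : 'rV[R]_n => v 0 i)) => //.
by move=> x _; exact: coord_continuous.
Qed.

(** Passes from the variation on [Omega], where [Phi_dom] is stated, to a dominated measure on a
    measurable carrier; it is applied to the two Jordan parts. *)
Lemma coord_integrable m (mu : {finite_measure set (borelRV R d) -> \bar R})
    (S : set (borelRV R d)) i :
  Phi_dom Omega phi m -> (forall A, measurable A -> (mu A <= variation m A)%E) ->
  measurable S -> S `<=` Omega -> variation m (~` S) = 0%E ->
  mu.-integrable S (EFin \o (fun x => phi x 0 i)).
Proof.
move=> [_ intm] mum mS SO vS.
have mf := coord_measurable i mS SO.
apply/integrableP; split => //.
have /integrableP[_] := intm i; apply: le_lt_trans.
rewrite (integral_concentrated _ mS SO vS).
exact: le_measure_integral_abs.
Qed.

(** Exchanging sum and integral turns the left side into the integral of [Phi_adj phi p] against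
    [m]. Each Jordan part then contributes at most [c] times its mass, and the masses add up to the
    norm. *)
Lemma dot_Phi_le m p (c : R) : Phi_dom Omega phi m -> 0 <= c ->
  (forall x, Omega x -> `|Phi_adj phi p x| <= c) ->
  \sum_i Phi Omega phi m 0 i * p 0 i <= c * tv_norm m.
Proof.
move=> Pm c0 gc; have [S [mS SO pS nS]] := radon_concentrated Pm.1.
have vS : variation m (~` S) = 0%E.
  by rewrite /variation/= /charge_variation/= pS nS adde0.
have ip i : (pos_part m).-integrable S (EFin \o (fun x => phi x 0 i)).
  apply: (coord_integrable _ Pm) => // A mA.
  by rewrite /variation/= /charge_variation/= leeDl.
have ineg i : (neg_part m).-integrable S (EFin \o (fun x => phi x 0 i)).
  apply: (coord_integrable _ Pm) => // A mA.
  by rewrite /variation/= /charge_variation/= leeDr.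
have H (mu : {finite_measure set (borelRV R d) -> \bar R}) :
    (forall i, mu.-integrable S (EFin \o (fun x => phi x 0 i))) ->
    `|\sum_i \int[mu]_(x in S) phi x 0 i * p 0 i| <= c * fine (mu setT).
  move=> imu.
  have igp i : mu.-integrable S (EFin \o (fun x => phi x 0 i * p 0 i)).
    by apply: (integrableZr mS (p 0 i) (imu i)).
  rewrite (eq_bigr (fun i => \int[mu]_(x in S) (phi x 0 i * p 0 i))); last first.
    by move=> i _; rewrite RintegralZr.
  rewrite -Rintegral_sum//; apply: normr_Rintegral_le => //.
    rewrite (_ : EFin \o _ = (fun x => \sum_i (phi x 0 i * p 0 i)%:E)%E); last first.
      by apply/funext => x /=; rewrite sumEFin.
    by apply: integrable_sum => // i _; exact: igp.
  by move=> x /SO; exact: gc.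
rewrite (eq_bigr (fun i => \int[pos_part m]_(x in S) phi x 0 i * p 0 i -
    \int[neg_part m]_(x in S) phi x 0 i * p 0 i)); last first.
  move=> i _; rewrite mxE mulrBl; congr (_ * _ - _ * _);
  by congr fine; apply: integral_concentrated.
rewrite sumrB tv_normE mulrDr lerD//.
  by apply: le_trans (H _ ip); exact: ler_norm.
by apply: le_trans (H _ ineg); rewrite -normrN ler_norm.
Qed.

End Phi_bound.

(** * Integrals over finite sets *)

Section finite_support.
Context (R : realType) (d : nat).

Lemma borel_finite (A : set 'rV[R]_d) :
  finite_set A -> measurable (A : set (borelRV R d)).
Proof. by move=> fA; apply: borel_compact; exact: finite_compact. Qed.

Lemma measurable_fun_finite_set (A : set 'rV[R]_d) (f : 'rV[R]_d -> R) :
  finite_set A -> measurable_fun (A : set (borelRV R d)) (f : borelRV R d -> R).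
Proof.
move=> fA _ Y _; apply: borel_finite.
by apply: sub_finite_set fA => x [].
Qed.

Lemma Rintegral_finite_set (mu : {finite_measure set (borelRV R d) -> \bar R})
    (s : seq 'rV[R]_d) (f : 'rV[R]_d -> R) : uniq s ->
  \int[mu]_(x in [set` s] : set (borelRV R d)) f x =
    \sum_(x <- s) f x * fine (mu [set x]).
Proof.
move=> us.
have m1 (x : 'rV[R]_d) : measurable ([set x] : set (borelRV R d)).
  exact: borel_finite.
have E : ([set` s] : set (borelRV R d)) = \big[setU/set0]_(x <- s) [set x].
  by rewrite -bigcup_seq; apply/seteqP; split=> [x xs|x [y /= ys ->]//]; exists x.
have tr : trivIset [set` s] (fun x : 'rV[R]_d => [set x]).
  by move=> x y _ _ [z [-> ->]].
rewrite /Rintegral E (@integral_bigsetU_EFin _ (borelRV R d) R mu _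
  (fun x : 'rV[R]_d => [set x] : set (borelRV R d)) f s)//; last first.
  apply/measurable_EFinP.
  by rewrite -E; apply: measurable_fun_finite_set; exact: finite_seq.
have H x : (\int[mu]_(z in ([set x] : set (borelRV R d))) (f z)%:E)%E =
    (f x * fine (mu [set x]))%:E.
  rewrite (eq_integral (cst (f x)%:E)); last by move=> z; rewrite inE => ->.
  by rewrite integral_cst// EFinM fineK// fin_num_measure.
under eq_bigr do rewrite H.
by rewrite sumEFin.
Qed.

End finite_support.

(** * Discrete measures: norm, image under [Phi], admissibility *)

Section discrete_facts.
Context (R : realType) (d n k : nat).
Variables (Omega : set 'rV[R]_d) (phi : 'rV[R]_d -> 'rV[R]_n).
Hypothesis hphi : {within Omega, continuous phi}.
Variables (beta : 'rV[R]_k) (X : 'M[R]_(k, d)).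

Lemma fine_discrete (A : set (borelRV R d)) :
  fine (discrete_measure beta X A) = \sum_j beta 0 j * \1_A (row j X).
Proof.
rewrite /discrete_measure.
under eq_bigr do rewrite /dirac -EFinM.
by rewrite sumEFin.
Qed.

Lemma discrete_tv_norm_ge (A : set (borelRV R d)) : measurable A ->
  \sum_j beta 0 j * (\1_A (row j X) - \1_(~` A) (row j X)) <=
  tv_norm (discrete_measure beta X).
Proof.
move=> mA; apply: le_trans (le_tv_norm _ mA).
rewrite !fine_discrete -sumrB; apply: ler_sum => j _.
by rewrite mulrBr.
Qed.

(** Rows of [X] may coincide and amplitudes may then cancel, so the norm can be smaller than the sum
    of the [|beta_j|]. A test-set formula is valid in all cases. *)
Lemma discrete_tv_norm_attained : exists2 A : set (borelRV R d), measurable A &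
  tv_norm (discrete_measure beta X) =
  \sum_j beta 0 j * (\1_A (row j X) - \1_(~` A) (row j X)).
Proof.
have [A mA ->] := tv_norm_attained (discrete_measure beta X).
exists A => //; rewrite !fine_discrete -sumrB; apply: eq_bigr => j _.
by rewrite mulrBr.
Qed.

(** The support candidates without repetition, so that each atom is integrated once. *)
Let s : seq 'rV[R]_d := undup [seq row j X | j <- enum 'I_k].

Let s_row j : row j X \in s.
Proof. by rewrite mem_undup; apply/mapP; exists j; rewrite ?mem_enum. Qed.

Let mS : measurable ([set` s] : set (borelRV R d)).
Proof. by apply: borel_finite; exact: finite_seq. Qed.

Let variation_discrete_off :
  variation (discrete_measure beta X) (~` [set` s] : set (borelRV R d)) = 0%E.
Proof.
have [P mP PE] := hahn_partsE (discrete_measure beta X).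
rewrite /variation/= /charge_variation/=.
have [-> ->] := PE _ (measurableC mS).
have Z (B : set (borelRV R d)) :
    (discrete_measure beta X : {charge set _ -> \bar R})
      (~` [set` s] `&` B) = 0%E.
  rewrite /= /discrete_measure big1// => j _.
  rewrite /dirac indicE memNset ?mule0//= => -[+ _]; apply.
  exact: s_row.
by rewrite !Z oppe0 adde0.
Qed.

Hypothesis hX : forall j, Omega (row j X).

Let sO : [set` s] `<=` Omega.
Proof. by move=> x /=; rewrite mem_undup => /mapP[j _ ->]. Qed.

Lemma Phi_discrete :
  Phi Omega phi (discrete_measure beta X) = \sum_j beta 0 j *: phi (row j X).
Proof.
have [pS nS] := pos_neg_part_concentrated mS variation_discrete_off.
apply/rowP => i; rewrite mxE summxE.
have E (mu : {finite_measure set (borelRV R d) -> \bar R}) :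
    mu (~` [set` s] : set (borelRV R d)) = 0%E ->
    \int[mu]_(x in Omega) phi x 0 i =
      \sum_(x <- s) phi x 0 i * fine (mu [set x]).
  move=> muS; rewrite -(Rintegral_finite_set _ _ (undup_uniq _)).
  by congr fine; exact: (integral_concentrated _ mS sO muS).
rewrite !E// -sumrB.
(* The mass of the atom [x] is the sum of the [beta_j] over all [j] with [x_j = x]. After the sums
   are exchanged, each [j] selects exactly one [x] in [s]. *)
transitivity (\sum_(x <- s) \sum_j phi x 0 i * (beta 0 j * (row j X == x)%:R)).
  apply: eq_bigr => x _; rewrite -mulrBr.
  rewrite -(pos_neg_partE (discrete_measure beta X)); last first.
    exact: borel_finite.
  rewrite fine_discrete mulr_sumr; apply: eq_bigr => j _.
  rewrite indicE (_ : (_ \in _) = (row j X == x))//.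
  by apply/idP/eqP; rewrite inE.
rewrite exchange_big/=; apply: eq_bigr => j _.
rewrite (bigD1_seq (row j X)) ?undup_uniq//= eqxx mulr1 big1 ?addr0.
  by rewrite mxE mulrC.
by move=> x; rewrite eq_sym => /negbTE ->; rewrite !mulr0.
Qed.

Lemma Phi_dom_discrete : Phi_dom Omega phi (discrete_measure beta X).
Proof.
split=> [e e0|i].
  exists [set` s]; split => //; first by apply: finite_compact; exact: finite_seq.
  by rewrite variation_discrete_off.
apply/integrableP; split.
  (* [measurable_fun] takes measurability of its domain as a premise, so this clause is available
     for an arbitrary [Omega]. *)
  by move=> mO; exact: (coord_measurable hphi i mO (@subset_refl _ Omega) mO).
rewrite (integral_concentrated _ mS sO variation_discrete_off).
have : (variation (discrete_measure beta X)).-integrable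
    ([set` s] : set (borelRV R d)) (EFin \o (fun x => phi x 0 i)).
  apply: measurable_bounded_integrable => //.
  - rewrite /variation/= /charge_variation/= lte_add_pinfty// ltey_eq.
      by rewrite fin_num_measure.
    by rewrite fin_num_measure.
  - by apply: measurable_fun_finite_set; exact: finite_seq.
  - exists (\sum_(x <- s) `|phi x 0 i|); split; first exact: num_real.
    move=> c sc x /= xs; apply: le_trans (ltW sc).
    by rewrite (bigD1_seq x) ?undup_uniq//= lerDl sumr_ge0.
by move=> /integrableP[].
Qed.

End discrete_facts.

(** * First-order optimality and uniqueness of [Phi m] *)

Section optimality.
Context (R : realType) (d n k : nat).
Variables (Omega : set 'rV[R]_d) (phi : 'rV[R]_d -> 'rV[R]_n).
Hypothesis hphi : {within Omega, continuous phi}.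
Variables (lam : R) (hlam : 0 < lam) (y : 'rV[R]_n).
Variables (beta : 'rV[R]_k) (X : 'M[R]_(k, d)).
Hypothesis hX : forall j, Omega (row j X).
Let m0 : {charge set (borelRV R d) -> \bar R} := discrete_measure beta X.
Hypothesis hsol : blasso_solution Omega phi lam y m0.
Let mu : 'rV[R]_n := \sum_j beta 0 j *: phi (row j X).
Let p := y - mu.

Lemma sqr_norm_scaleB (s : R) (q r : 'rV[R]_n) :
  \sum_i (s *: q - r) 0 i ^+ 2 =
  s ^+ 2 * \sum_i q 0 i ^+ 2 - 2 * s * \sum_i q 0 i * r 0 i + \sum_i r 0 i ^+ 2.
Proof.
rewrite !mulr_sumr -sumrB -big_split/=; apply: eq_bigr => i _.
by rewrite !mxE; ring.
Qed.

Lemma Phi_adj_sum l (c : 'rV[R]_l) (Y : 'M[R]_(l, d)) (r : 'rV[R]_n) :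
  \sum_i (\sum_j c 0 j *: phi (row j Y)) 0 i * r 0 i =
  \sum_j c 0 j * Phi_adj phi r (row j Y).
Proof.
under eq_bigr do rewrite summxE mulr_suml.
rewrite exchange_big/=; apply: eq_bigr => j _; rewrite /Phi_adj mulr_sumr.
by apply: eq_bigr => i _; rewrite mxE mulrA.
Qed.

Let blasso_obj_discrete : blasso_obj Omega phi lam y m0 =
  2^-1 * \sum_i p 0 i ^+ 2 + lam * tv_norm m0.
Proof.
rewrite /blasso_obj Phi_discrete//; congr (_ * _ + _).
by apply: eq_bigr => i _; rewrite !mxE -sqrrN opprB.
Qed.

Let le0_of_le_mul (a b : R) : 0 <= b ->
  (forall s, 0 < s -> s <= 1 -> a <= s * b) -> a <= 0.
Proof.
move=> b0 H; rewrite leNgt; apply/negP => a0.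
have ab : 0 < a + b by rewrite ltr_wpDr.
(* If [a > 0], the choice [s = a / (a + b)] is admissible and gives [a + b <= b]. *)
have := H (a / (a + b)); rewrite divr_gt0// ler_pdivrMr// mul1r lerDl b0.
move=> /(_ isT isT); rewrite mulrAC ler_pdivlMr// ler_pM2l//.
by rewrite gerDr leNgt a0.
Qed.

Let indic_sub (T : Type) (A : set T) x : `|\1_A x - \1_(~` A) x| <= 1 :> R.
Proof.
rewrite !indicE; have [xA|xA] := boolP (x \in A); rewrite in_setC.
  by rewrite xA subr0 normr1.
by rewrite xA sub0r normrN1.
Qed.

(* First-order optimality along the segment from the solution to an arbitrary
   discrete measure. *)
Lemma discrete_optimality l (c : 'rV[R]_l) (Y : 'M[R]_(l, d)) :
  (forall j, Omega (row j Y)) ->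
  \sum_j c 0 j * Phi_adj phi p (row j Y) - lam * \sum_j `|c 0 j| <=
  \sum_i mu 0 i * p 0 i - lam * tv_norm m0.
Proof.
move=> hY.
pose nu : 'rV[R]_n := \sum_j c 0 j *: phi (row j Y).
rewrite -subr_le0 -Phi_adj_sum -/nu.
(* The objective along the segment is bounded by a quadratic in [s]. After division by [s] only the
   second-order term keeps a factor [s], and it disappears as [s] tends to 0. *)
apply: (@le0_of_le_mul _ (2^-1 * \sum_i (nu - mu) 0 i ^+ 2)).
  by rewrite mulr_ge0// sumr_ge0// => i _; rewrite sqr_ge0.
move=> s s0 s1.
(* The convex combination is again a discrete measure, on the concatenated list of positions. *)
pose b' := row_mx ((1 - s) *: beta) (s *: c).
pose X' := col_mx X Y.
have hX' j : Omega (row j X').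
  by rewrite -[j]splitK; case: (fintype.split j) => j'; rewrite ?rowKu ?rowKd.
have := hsol.2 _ (Phi_dom_discrete hphi b' hX').
rewrite blasso_obj_discrete.
have -> : blasso_obj Omega phi lam y (discrete_measure b' X') =
    2^-1 * \sum_i (s *: (nu - mu) - p) 0 i ^+ 2 +
    lam * tv_norm (discrete_measure b' X').
  rewrite /blasso_obj Phi_discrete//; congr (_ * _ + _).
  apply: eq_bigr => i _; congr (_ ^+ 2); congr (fun_of_matrix _ _ _).
  rewrite big_split_ord/=.
  rewrite (eq_bigr (fun j => (1 - s) *: (beta 0 j *: phi (row j X)))); last first.
    by move=> j _; rewrite row_mxEl mxE rowKu scalerA.
  rewrite [X in _ + X - _](eq_bigr
    (fun j => s *: (c 0 j *: phi (row j Y)))); last first.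
    by move=> j _; rewrite row_mxEr mxE rowKd scalerA.
  rewrite -!scaler_sumr -/mu -/nu /p; apply/rowP => a; rewrite !mxE; ring.
(* Convexity of the norm: a set attaining it for the combination is a test set for [m0], and against
   [c] it contributes at most the sum of the [|c_j|]. *)
have tvle : tv_norm (discrete_measure b' X') <=
    (1 - s) * tv_norm m0 + s * \sum_j `|c 0 j|.
  have [A mA ->] := discrete_tv_norm_attained b' X'.
  rewrite big_split_ord/= lerD//.
    apply: le_trans (ler_wpM2l _ (discrete_tv_norm_ge beta X mA)); last by rewrite subr_ge0.
    rewrite mulr_sumr ler_sum// => j _.
    by rewrite row_mxEl mxE rowKu mulrA.
  rewrite mulr_sumr ler_sum// => j _.
  rewrite row_mxEr mxE rowKd -mulrA ler_wpM2l ?(ltW s0)//.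
  apply: le_trans (ler_norm _) _; rewrite normrM.
  by rewrite ler_piMr.
rewrite sqr_norm_scaleB => Hle.
have tvle' := ler_wpM2l (ltW hlam) tvle.
have E : \sum_i (nu - mu) 0 i * p 0 i =
    \sum_i nu 0 i * p 0 i - \sum_i mu 0 i * p 0 i.
  by rewrite -sumrB; apply: eq_bigr => i _; rewrite !mxE mulrBl.
rewrite E in Hle.
rewrite -(ler_pM2l s0).
move: (\sum_i nu 0 i * p 0 i) (\sum_i mu 0 i * p 0 i) (tv_norm m0)
  (tv_norm (discrete_measure b' X')) (\sum_j `|c 0 j|)
  (\sum_i (nu - mu) 0 i ^+ 2) (\sum_i p 0 i ^+ 2) Hle tvle' => *.
nra.
Qed.

(** Comparison with the zero measure, that is, the case of no atoms. *)
Lemma dual_tv_norm : lam * tv_norm m0 <= \sum_i mu 0 i * p 0 i.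
Proof.
have Y0 (j : 'I_0) : Omega (row j 0) by case: j.
have := discrete_optimality 0 Y0.
by rewrite !big_ord0 mulr0 subr0 subr_ge0.
Qed.

Lemma dual_bound x : Omega x -> `|Phi_adj phi p x| <= lam.
Proof.
move=> Ox; rewrite leNgt; apply/negP => lt.
set a := Phi_adj phi p x in lt.
set K := \sum_i mu 0 i * p 0 i - lam * tv_norm m0.
(* A single atom of amplitude [t * sg a] at [x] would give [t * (|a| - lam) <= K]; this [t] makes
   the left side [|K| + 1]. *)
pose t := (`|K| + 1) / (`|a| - lam).
have t0 : 0 <= t by apply: divr_ge0; [exact: addr_ge0|rewrite subr_ge0 ltW].
have xO (j : 'I_1) : Omega (row j x) by rewrite row_id.
have := discrete_optimality (const_mx (t * Num.sg a)) xO.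
rewrite !big_ord1 !mxE row_id -/a -/K -mulrA -normrEsg normrM (ger0_norm t0).
have -> : `|Num.sg a| = 1.
  by rewrite normr_sg -normr_gt0 (lt_trans hlam).
rewrite mulr1 [lam * t]mulrC -mulrBr divfK; last by rewrite gt_eqF ?subr_gt0.
by rewrite leNgt (le_lt_trans (ler_norm K))// ltrDl.
Qed.

Lemma Phi_solution_unique m : blasso_solution Omega phi lam y m ->
  Phi Omega phi m = mu.
Proof.
move=> [Pm mopt].
have := dot_Phi_le hphi Pm (ltW hlam) dual_bound.
have := mopt _ hsol.1.
rewrite blasso_obj_discrete.
have := dual_tv_norm.
set v := Phi Omega phi m.
rewrite /blasso_obj -/v.
have -> : v - y = 1 *: (v - mu) - p by apply/rowP => i; rewrite !mxE; ring.
rewrite sqr_norm_scaleB.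
have -> : \sum_i (v - mu) 0 i * p 0 i =
    \sum_i v 0 i * p 0 i - \sum_i mu 0 i * p 0 i.
  by rewrite -sumrB; apply: eq_bigr => i _; rewrite !mxE mulrBl.
(* [h1] is the dual inequality for the discrete solution, [h2] the optimality of [m], [h3] the
   duality bound for [v]. Their sum leaves half the squared norm of [v - mu] below 0. *)
move=> h1 h2 h3.
have : \sum_i (v - mu) 0 i ^+ 2 <= 0.
  move: (\sum_i v 0 i * p 0 i) (\sum_i mu 0 i * p 0 i) (tv_norm m0)
    (tv_norm m) (\sum_i (v - mu) 0 i ^+ 2) (\sum_i p 0 i ^+ 2) h1 h2 h3 => *.
  lra.
move=> le0; apply/rowP => i; apply/eqP; rewrite -subr_eq0.
have s0 j : true -> 0 <= (v - mu) 0 j ^+ 2 by rewrite sqr_ge0.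
have /eqP : \sum_i (v - mu) 0 i ^+ 2 = 0.
  by apply/eqP; rewrite eq_le le0 sumr_ge0.
by rewrite psumr_eq0// => /allP/(_ i (mem_index_enum _)); rewrite sqrf_eq0 !mxE.
Qed.

(** For distinct positions the norm dominates the sum of the [|beta_j|]. With [dual_tv_norm], the
    nonnegative gaps [lam * |beta_i| - beta_i * Phi_adj phi p x_i] have a nonpositive sum, so each
    of them vanishes. *)
Lemma dual_sign j : injective (fun i => row i X) -> beta 0 j != 0 ->
  Phi_adj phi p (row j X) = lam * Num.sg (beta 0 j).
Proof.
move=> injX bj0.
have tvge : \sum_j `|beta 0 j| <= tv_norm m0.
  (* The test set collects the positions with positive amplitude; injectivity keeps all other
     positions out of it. *)
  pose A : set (borelRV R d) := (fun i => row i X) @` [set i | 0 < beta 0 i].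
  have mA : measurable A.
    by apply: borel_finite; apply: finite_image; exact: finite_finset.
  apply: le_trans (discrete_tv_norm_ge beta X mA).
  apply: ler_sum => i _; rewrite !indicE in_setC.
  have -> : (row i X \in A) = (0 < beta 0 i).
    apply/idP/idP; rewrite inE; first by move=> [i' /= + /injX <-].
    by move=> bi; exists i.
  case: ltP => bi; rewrite /= ?subr0 ?mulr1 ?sub0r ?mulrN1; first by rewrite gtr0_norm.
  by rewrite ler0_norm.
have le1 i : beta 0 i * Phi_adj phi p (row i X) <= lam * `|beta 0 i|.
  apply: le_trans (ler_norm _) _; rewrite normrM mulrC ler_wpM2r//.
  exact: dual_bound.
have : \sum_i (lam * `|beta 0 i| - beta 0 i * Phi_adj phi p (row i X)) <= 0.
  rewrite sumrB -mulr_sumr -Phi_adj_sum -/mu subr_le0.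
  by apply: le_trans dual_tv_norm; rewrite ler_pM2l.
move=> le0.
have s0 i : true -> 0 <= lam * `|beta 0 i| - beta 0 i * Phi_adj phi p (row i X).
  by rewrite subr_ge0.
have /eqP : \sum_i (lam * `|beta 0 i| - beta 0 i * Phi_adj phi p (row i X)) = 0.
  by apply/eqP; rewrite eq_le le0 sumr_ge0.
rewrite psumr_eq0// => /allP/(_ j (mem_index_enum _))/=.
rewrite subr_eq0 => /eqP E.
by apply: (mulfI bj0); rewrite -E normrEsg; ring.
Qed.

End optimality.

(** * Directional derivatives of pairings and at local maxima *)

Section derive_extra.
Context (R : realType).

(** Difference quotients with positive step are nonpositive, and the derivative is also their limit
    from the right. *)
Lemma derive_local_max_le0 (V : normedModType R) (f : V -> R) (a v : V) :
  derivable f a v -> (\forall x \near a, f x <= f a) -> 'D_v f a <= 0.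
Proof.
move=> dfa fmax.
have cvg_av : (h *: v + a) @[h --> (0 : R)] --> a.
  rewrite -[X in _ --> X]add0r -[X in _ --> X + _](scale0r v).
  by apply: cvgD; [apply: cvgZr_tmp; exact: cvg_id|exact: cvg_cst].
have right_sub : (0 : R)^'+ `=>` 0^'.
  move=> A [e egt0 Ae]; exists e => // x xe xgt0; apply: Ae => //.
  exact/lt0r_neq0.
have fa_right : (fun h : R => h^-1 *: ((f \o shift a) (h *: v) - f a)) @ 0^'+
    --> 'D_v f a.
  apply: cvg_trans dfa; exact: cvg_app.
rewrite -(cvg_lim (@Rhausdorff R) fa_right); apply: limr_le.
  by apply/cvg_ex; exists ('D_v f a).
near=> h; apply: mulr_ge0_le0.
  by rewrite invr_ge0 ltW.
rewrite subr_le0 /=; near: h; apply: cvg_within.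
exact: (cvg_av _ fmax).
Unshelve. all: by end_near. Qed.

Lemma is_derive_sumM (V : normedModType R) n (f g : 'I_n -> V -> R) (x v : V)
    (df dg : 'I_n -> R) :
  (forall i, is_derive x v (f i) (df i)) ->
  (forall i, is_derive x v (g i) (dg i)) ->
  is_derive x v (fun y => \sum_i f i y * g i y)
    (\sum_i (f i x * dg i + df i * g i x)).
Proof.
move=> fd gd.
have -> : (fun y => \sum_i f i y * g i y) = \sum_i (f i * g i).
  by apply/funext => y; rewrite fct_sumE.
apply: is_derive_sum => i.
apply: (is_derive_eq (is_deriveM (fd i) (gd i))).
by rewrite /GRing.scale/= [df i * _]mulrC.
Qed.

Lemma derive_near_cst (V : normedModType R) (f : V -> R) (x v : V) (c df : R) :
  (\forall y \near x, f y = c) -> is_derive x v f df -> df = 0.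
Proof.
move=> fc [_ <-].
by rewrite (@near_eq_derive _ _ _ f (cst c) x v)// derive_cst.
Qed.

Lemma is_derive_coord (V : normedModType R) m n (f : V -> 'M[R]_(m, n))
    (x v : V) i j :
  derivable f x v -> is_derive x v (fun y => f y i j) ('D_v f x i j).
Proof.
move=> df; apply: DeriveDef; first by move/derivable_mxP : df.
by rewrite derive_mx// mxE.
Qed.

Lemma is_derive_Phi_adj d n (phi : 'rV[R]_d -> 'rV[R]_n) (p : 'rV[R]_n)
    (x u : 'rV[R]_d) : differentiable phi x ->
  is_derive x u (Phi_adj phi p) (\sum_i (u *m jacobian phi x) 0 i * p 0 i).
Proof.
move=> dphi; apply: is_derive_eq.
  apply: (@is_derive_sumM _ n (fun i x => phi x 0 i) (fun i _ => p 0 i) x u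
     (fun i => (u *m jacobian phi x) 0 i) (fun=> 0)) => i.
  rewrite -deriveEjacobian//; apply: is_derive_coord.
  exact: diff_derivable.
by apply: eq_bigr => i _; rewrite mulr0 add0r.
Qed.

End derive_extra.

(** * Gradient and Hessian of the dual certificate *)

Section dual_gradient.
Context (R : realType) (d n : nat).
Variables (Omega : set 'rV[R]_d) (phi : 'rV[R]_d -> 'rV[R]_n).

Lemma Phi_adjZ (s : R) (p : 'rV[R]_n) x :
  Phi_adj phi (s *: p) x = s * Phi_adj phi p x.
Proof.
rewrite /Phi_adj mulr_sumr; apply: eq_bigr => i _; rewrite mxE; ring.
Qed.

(** Multiplying by the sign [s] turns the extremum into an interior maximum with value [lam]. The
    derivatives along [u] and [-u] are then both nonpositive. *)
Lemma Phi_adj_extremum (p : 'rV[R]_n) (lam s : R) (x : 'rV[R]_d) a :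
  s ^+ 2 = 1 -> (forall z, Omega z -> `|Phi_adj phi p z| <= lam) ->
  Phi_adj phi p x = lam * s -> interior Omega x -> differentiable phi x ->
  \sum_i jacobian phi x a i * p 0 i = 0.
Proof.
move=> s1 bnd px intx dphi.
have le0 (u : 'rV[R]_d) : \sum_i (u *m jacobian phi x) 0 i * (s *: p) 0 i <= 0.
  have [dfx <-] := is_derive_Phi_adj (s *: p) u dphi.
  apply: derive_local_max_le0 => //.
  near=> z; rewrite !Phi_adjZ px mulrCA -expr2 s1 mulr1.
  apply: le_trans (ler_norm _) _; rewrite normrM.
  have -> : `|s| = 1.
    by apply/eqP; rewrite -sqrp_eq1// -normrX s1 normr1.
  rewrite mul1r; apply: bnd; near: z; exact: intx.
have e0 : \sum_i ((delta_mx 0 a : 'rV[R]_d) *m jacobian phi x) 0 i *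
    (s *: p) 0 i = 0.
  apply/eqP; rewrite eq_le le0 /= -oppr_le0 -sumrN.
  have := le0 (- delta_mx 0 a); congr (_ <= _); apply: eq_bigr => i _.
  by rewrite mulNmx mxE mulNr.
have s0 : s != 0.
  by apply: contra_eq_neq s1 => ->; rewrite expr0n eq_sym oner_eq0.
apply: (mulfI s0); rewrite mulr0 -[RHS]e0 mulr_sumr; apply: eq_bigr => i _.
by rewrite -rowE !mxE; ring.
Unshelve. all: by end_near. Qed.

(** Near [x] the gradient is the Jacobian paired with the fixed vector [p], so a second
    differentiation acts on the Jacobian alone. *)
Lemma hessian_Phi_adj (p : 'rV[R]_n) (x u : 'rV[R]_d) a :
  (\forall z \near x, differentiable phi z) -> differentiable (jacobian phi) x ->
  \sum_b hessian (Phi_adj phi p) x a b * u 0 b =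
  \sum_i ('d (jacobian phi) x u) a i * p 0 i.
Proof.
move=> dphi dJ.
have H b : hessian (Phi_adj phi p) x a b =
    \sum_i ('d (jacobian phi) x (delta_mx 0 b)) a i * p 0 i.
  rewrite mxE (@near_eq_derive _ _ _ _
    (fun z => \sum_i jacobian phi z a i * p 0 i)); last first.
    near=> z; have dz : differentiable phi z by near: z.
    have [_ ->] := is_derive_Phi_adj p (delta_mx 0 a) dz.
    by apply: eq_bigr => i _; rewrite -rowE mxE.
  have [] : is_derive x (delta_mx 0 b : 'rV[R]_d)
      (fun z => \sum_i jacobian phi z a i * p 0 i)
      (\sum_i ('d (jacobian phi) x (delta_mx 0 b)) a i * p 0 i).
    apply: is_derive_eq.
      apply: (@is_derive_sumM _ _ n (fun i z => jacobian phi z a i)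
        (fun i _ => p 0 i) x (delta_mx 0 b)
        (fun i => ('d (jacobian phi) x (delta_mx 0 b)) a i) (fun=> 0)) => i.
      rewrite -deriveE//; apply: is_derive_coord.
      exact: diff_derivable.
    by apply: eq_bigr => i _; rewrite mulr0 add0r.
  by move=> _ ->.
under eq_bigr do rewrite H mulr_suml.
rewrite exchange_big/=; apply: eq_bigr => i _.
rewrite [in RHS](row_sum_delta u) linear_sum/= summxE mulr_suml.
apply: eq_bigr => b _; rewrite linearZ/= mxE; ring.
Unshelve. all: by end_near. Qed.

End dual_gradient.

(** * The linear system governed by [M] *)

Section linear_system.
Context (R : realType) (d n k : nat).
Variables (phi : 'rV[R]_d -> 'rV[R]_n) (X : 'M[R]_(k, d)) (Q : 'I_k -> 'M[R]_d).
Let G := Gamma_mx phi X.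

(* If two positions coincide, then the vector with amplitudes 1 and -1 there is
   in the kernel, because the second-order block does not see amplitudes. *)
Lemma M_mx_unit_row_inj : M_mx G Q \in unitmx -> injective (fun i => row i X).
Proof.
move=> Mu i j ij; apply/eqP/negPn/negP => nij.
pose w : 'cV[R]_(k + \sum_(j < k) d) :=
  col_mx (delta_mx i 0 - delta_mx j 0) 0.
have Gw : G *m w = 0.
  rewrite mul_row_col mulmx0 addr0 mulmxBr -!colE.
  apply/colP => a; rewrite !mxE.
  by rewrite ij subrr.
have Mw : M_mx G Q *m w = 0.
  rewrite mulmxDl -mulmxA Gw mulmx0 add0r mul_block_col !mul0mx mulmx0 !addr0.
  by rewrite col_mx0.
have : w = 0 by rewrite -(mulKmx Mu w) Mw mulmx0.
move=> /matrixP/(_ (lshift _ i) 0); rewrite /w col_mxEu !mxE !eqxx (negbTE nij).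
by rewrite subr0 => /eqP; rewrite oner_eq0.
Qed.

(** [r] stands for the derivative of the residual and [dx j] for the displacement already multiplied
    by the amplitude. The last two hypotheses are the two row blocks of [G^T r = diag (0, Q) w];
    adding [G^T G w] to both sides gives [M w = G^T v]. *)
Lemma Gamma_mx_solve (db : 'cV[R]_k) (dx : 'I_k -> 'cV[R]_d) (v r : 'cV[R]_n) :
  M_mx G Q \in unitmx ->
  r = v - (\sum_j db j 0 *: (phi (row j X))^T +
           \sum_j (jacobian phi (row j X))^T *m dx j) ->
  (forall j, phi (row j X) *m r = 0) ->
  (forall j, jacobian phi (row j X) *m r = Q j *m dx j) ->
  v - r = G *m invmx (M_mx G Q) *m G^T *m v.
Proof.
move=> Mu rE h1 h2.
pose w := col_mx db (\mxcol_j dx j).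
have Gw : G *m w = v - r.
  rewrite rE opprB addrC subrK mul_row_col; congr (_ + _).
    apply/colP => i; rewrite !mxE summxE; apply: eq_bigr => j _.
    by rewrite !mxE mulrC.
  by rewrite /Phi1_mx mul_mxrow_mxcol.
have Gr : G^T *m r = block_mx 0 0 0 (\mxdiag_j Q j) *m w.
  rewrite tr_row_mx mul_col_mx mul_block_col !mul0mx !add0r; congr col_mx.
    apply/colP => j; transitivity ((phi (row j X) *m r) 0 0).
      by rewrite !mxE; apply: eq_bigr => i _; rewrite !mxE.
    by rewrite h1 !mxE.
  rewrite /Phi1_mx tr_mxrow mul_mxdiag_mxcol.
  under eq_mxcol do rewrite trmxK.
  by rewrite mxcol_mul; exact/eq_mxcol.
have Mw : M_mx G Q *m w = G^T *m v.
  rewrite mulmxDl -Gr -mulmxA Gw -mulmxDr.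
  by rewrite subrK.
by rewrite -!mulmxA -Mw (mulKmx Mu) Gw.
Qed.

End linear_system.

Lemma differentiable_row (R : realType) k d (j : 'I_k) (M : 'M[R]_(k, d)) :
  differentiable (row j : 'M[R]_(k, d) -> 'rV[R]_d) M.
Proof.
have -> : (row j : 'M[R]_(k, d) -> 'rV[R]_d) =
    \sum_(a < d) (fun N : 'M[R]_(k, d) => N j a *: (delta_mx 0 a : 'rV[R]_d)).
  apply/funext => N; rewrite fct_sumE [LHS]row_sum_delta.
  by apply: eq_bigr => a _; rewrite mxE.
apply: differentiable_sum => a; apply: differentiableZl.
exact: differentiable_coord.
Qed.

(** * Differentiating the optimality identities at [ybar] *)

Section implicit_differentiation.
Context (R : realType) (d n k : nat) (lam : R) (phi : 'rV[R]_d -> 'rV[R]_n).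
Variables (ybar : 'rV[R]_n) (beta : 'rV[R]_n -> 'rV[R]_k).
Variable X : 'rV[R]_n -> 'M[R]_(k, d).
Hypothesis dbeta : differentiable beta ybar.
Hypothesis dX : differentiable X ybar.
Hypothesis hphi1 :
  forall j, \forall x \near row j (X ybar), differentiable phi x.
Hypothesis hphi2 : forall j, differentiable (jacobian phi) (row j (X ybar)).
Hypothesis hbeta : forall j, beta ybar 0 j != 0.
Let mu y := \sum_j beta y 0 j *: phi (row j (X y)).
Let p y := y - mu y.
Variable s : 'I_k -> R.
Hypothesis dual_val :
  forall j, \forall y \near ybar, Phi_adj phi (p y) (row j (X y)) = s j.
Hypothesis dual_crit : forall j a, \forall y \near ybar,
  \sum_i jacobian phi (row j (X y)) a i * p y 0 i = 0.
Let Q j := - (lam / beta ybar 0 j) *: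
  hessian (Phi_adj phi (lam^-1 *: p ybar)) (row j (X ybar)).
Let G := Gamma_mx phi (X ybar).

Lemma is_derive_mu (v : 'rV[R]_n) i : lam != 0 -> M_mx G Q \in unitmx ->
  is_derive ybar v (fun y => mu y 0 i)
    ((G *m invmx (M_mx G Q) *m G^T *m v^T) i 0).
Proof.
move=> lam0 Mu.
have drow j : differentiable (fun y => row j (X y)) ybar.
  exact: (differentiable_comp dX (differentiable_row _ _)).
have dphi j : differentiable phi (row j (X ybar)) := nbhs_singleton (hphi1 j).
pose db j := 'D_v beta ybar 0 j.
pose dx j := 'd (fun y => row j (X y)) ybar v : 'rV[R]_d.
pose J j := jacobian phi (row j (X ybar)).
pose dJ j := 'd (jacobian phi) (row j (X ybar)) (dx j) : 'M[R]_(d, n).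
have beta_d j : is_derive ybar v (fun y => beta y 0 j) (db j).
  by apply: is_derive_coord; exact: diff_derivable.
have phi_d j i' :
    is_derive ybar v (fun y => phi (row j (X y)) 0 i') ((dx j *m J j) 0 i').
  have dc : differentiable (phi \o (fun y => row j (X y))) ybar.
    exact: differentiable_comp.
  have <- : 'D_v (phi \o (fun y => row j (X y))) ybar = dx j *m J j.
    by rewrite deriveE// diff_comp//= mul_rV_lin1.
  by apply: (is_derive_coord (f := phi \o _)); exact: diff_derivable.
have J_d j a i' :
    is_derive ybar v (fun y => jacobian phi (row j (X y)) a i') (dJ j a i').
  have dc : differentiable (jacobian phi \o (fun y => row j (X y))) ybar.
    exact: differentiable_comp.
  have <- : 'D_v (jacobian phi \o (fun y => row j (X y))) ybar = dJ j.
    by rewrite deriveE// diff_comp.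
  by apply: (is_derive_coord (f := jacobian phi \o _)); exact: diff_derivable.
pose dmu i' := \sum_j (beta ybar 0 j * (dx j *m J j) 0 i' +
                       db j * phi (row j (X ybar)) 0 i').
have mu_d i' : is_derive ybar v (fun y => mu y 0 i') (dmu i').
  have -> : (fun y => mu y 0 i') =
      (fun y => \sum_j beta y 0 j * phi (row j (X y)) 0 i').
    by apply/funext => y; rewrite summxE; apply: eq_bigr => j _; rewrite mxE.
  exact: is_derive_sumM.
pose r : 'rV[R]_n := \row_i' (v 0 i' - dmu i').
have p_d i' : is_derive ybar v (fun y => p y 0 i') (r 0 i').
  have -> : (fun y => p y 0 i') =
      (fun y : 'rV[R]_n => y 0 i' : R) - (fun y => mu y 0 i' : R).
    by apply/funext => y; rewrite !mxE.
  rewrite mxE; apply: is_deriveB.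
  have := @is_derive_coord _ _ _ _ id ybar v 0 i'; rewrite derive_id; apply.
  exact: derivable_id.
have E1 j : \sum_i' phi (row j (X ybar)) 0 i' * r 0 i' = 0.
  have := derive_near_cst (dual_val j) (is_derive_sumM (phi_d j) p_d).
  rewrite big_split/= [X in _ + X = _](_ : _ = 0) ?addr0//.
  (* The term coming from the moving position is [dx_j] paired with the gradient at [x_j], which is
     zero by [dual_crit]. *)
  under eq_bigr do rewrite mxE mulr_suml.
  rewrite exchange_big big1//= => a _.
  under eq_bigr do rewrite -mulrA.
  by rewrite -mulr_sumr (nbhs_singleton (dual_crit j a)) mulr0.
have E2 j a : \sum_i' J j a i' * r 0 i' = - \sum_i' dJ j a i' * p ybar 0 i'.
  have := derive_near_cst (dual_crit j a) (is_derive_sumM (J_d j a) p_d).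
  by rewrite big_split/= => /eqP; rewrite addr_eq0 => /eqP.
(* The certificate is built from [p / lam], hence the factor [lam] in front of its Hessian. *)
have E3 j a : \sum_i' dJ j a i' * p ybar 0 i' =
    lam * \sum_b hessian (Phi_adj phi (lam^-1 *: p ybar))
                   (row j (X ybar)) a b * dx j 0 b.
  rewrite hessian_Phi_adj// mulr_sumr; apply: eq_bigr => i' _.
  have -> : (lam^-1 *: p ybar) 0 i' = lam^-1 * p ybar 0 i' by rewrite [LHS]mxE.
  by field.
suff <- : dmu i = (G *m invmx (M_mx G Q) *m G^T *m v^T) i 0 by exact: mu_d.
rewrite -(@Gamma_mx_solve _ _ _ _ phi (X ybar) Q (\col_j db j)
  (fun j => beta ybar 0 j *: (dx j)^T) v^T r^T Mu).
- by rewrite !mxE opprB addrC subrK.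
- apply/colP => i'; rewrite !mxE; congr (_ - _).
  rewrite /dmu big_split/= addrC !summxE; congr (_ + _).
    by apply: eq_bigr => j _; rewrite !mxE.
  apply: eq_bigr => j _; by rewrite -scalemxAr -trmx_mul [RHS]mxE [in RHS]mxE.
- move=> j; apply/matrixP => a b; rewrite !mxE !ord1 -[RHS](E1 j).
  by apply: eq_bigr => i' _; rewrite !mxE.
(* The amplitude in the scaled displacement cancels the [1 / beta_j] in [Q j]; the minus sign is the
   one in [E2]. *)
- move=> j; apply/colP => a.
  transitivity (\sum_i' J j a i' * r 0 i').
    by rewrite mxE; apply: eq_bigr => i' _; rewrite [r^T _ _]mxE.
  rewrite E2 E3 mxE mulr_sumr -sumrN; apply: eq_bigr => b _.
  by rewrite !mxE; field.
Qed.

End implicit_differentiation.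

(** * From the hypotheses at [ybar] to a neighbourhood, and the divergence formula *)

Section pair_differentiable.
Context (R : realType) (U V W : normedModType R) (f : U -> V) (g : U -> W).
Variable x : U.

Lemma differentiable_pair_fst :
  differentiable (fun z => (f z, g z)) x -> differentiable f x.
Proof.
move=> dfg; apply: (differentiable_comp (g := fst) dfg).
by apply: linear_differentiable => z; exact: cvg_fst.
Qed.

Lemma differentiable_pair_snd :
  differentiable (fun z => (f z, g z)) x -> differentiable g x.
Proof.
move=> dfg; apply: (differentiable_comp (g := snd) dfg).
by apply: linear_differentiable => z; exact: cvg_snd.
Qed.

End pair_differentiable.

(** Makes the certificate values [lam * sg (beta_j)] locally constant, so that their derivative is
    zero. *)
Lemma near_sg (R : realType) (T : topologicalType) (f : T -> R) (x : T) :
  {for x, continuous f} -> f x != 0 ->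
  \forall y \near x, Num.sg (f y) = Num.sg (f x).
Proof.
move=> cf fx0; have [fx|fx|/eqP] := ltgtP (f x) 0; last by rewrite (negbTE fx0).
  near=> y; rewrite !ltr0_sg//; near: y; exact: (cvgr_lt _ cf).
near=> y; rewrite !gtr0_sg//; near: y; exact: (cvgr_gt _ cf).
Unshelve. all: by end_near. Qed.

Theorem theorem1 (R : realType) (d n k : nat) (lam : R) (hlam : 0 < lam)
  (Omega : set 'rV[R]_d) (phi : 'rV[R]_d -> 'rV[R]_n)
  (hphi : {within Omega, continuous phi})
  (ybar : 'rV[R]_n) (U : set 'rV[R]_n) (hU : nbhs ybar U)
  (beta : 'rV[R]_n -> 'rV[R]_k) (X : 'rV[R]_n -> 'M[R]_(k, d))
  (hX : forall y, U y -> forall j, Omega (row j (X y)))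
  (hsol : forall y, U y ->
     blasso_solution Omega phi lam y (discrete_measure (beta y) (X y)))
  (hdiff : forall y, (interior U) y ->
     differentiable (fun z => (beta z, X z)) y)
  (hbeta : forall j, beta ybar 0 j != 0)
  (hint : forall j, (interior Omega) (row j (X ybar)))
  (hphi1 : forall j, \forall x \near row j (X ybar), differentiable phi x)
  (hphi2 : forall j, differentiable (jacobian phi) (row j (X ybar)))
  (m : 'rV[R]_n -> {charge set (borelRV R d) -> \bar R})
  (hm : forall y, U y -> blasso_solution Omega phi lam y (m y)) :
  let eta := dual_cert Omega phi lam ybar (m ybar) in
  let Q := fun j : 'I_k =>
    - (lam / beta ybar 0 j) *: hessian eta (row j (X ybar)) in
  let G := Gamma_mx phi (X ybar) in
  let M := M_mx G Q in
  let muhat := fun y => Phi Omega phi (m y) in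
  M \in unitmx ->
  has_partials muhat ybar /\
  divergence muhat ybar = \tr (G *m invmx M *m G^T).
Proof.
move=> eta Q G M muhat Mu.
have Uybar := nbhs_singleton hU.
have dbeta : differentiable beta ybar := differentiable_pair_fst (hdiff ybar hU).
have dX : differentiable X ybar := differentiable_pair_snd (hdiff ybar hU).
have crow j : {for ybar, continuous (fun y => row j (X y))}.
  apply: differentiable_continuous.
  exact: (differentiable_comp dX (differentiable_row _ _)).
have cbeta j : {for ybar, continuous (fun y => beta y 0 j)}.
  apply: differentiable_continuous.
  exact: (differentiable_comp dbeta (differentiable_coord _ _ _)).
have injbar := M_mx_unit_row_inj Mu.
pose mu y := \sum_j beta y 0 j *: phi (row j (X y)).
pose p y := y - mu y.
have muE y : U y -> muhat y = mu y.
  move=> Uy; apply: (Phi_solution_unique hphi hlam (hX y Uy) (hsol y Uy)).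
  exact: hm.
(* There are finitely many pairs of positions, and each pair distinct at [ybar] stays distinct
   nearby by continuity. *)
have inj_near : \forall y \near ybar, injective (fun j => row j (X y)).
  have H (ij : 'I_k * 'I_k) :
      \forall y \near ybar, row ij.1 (X y) = row ij.2 (X y) -> ij.1 = ij.2.
    have [eij|nij] := eqVneq ij.1 ij.2; first by near=> y.
    have cB : (fun y => row ij.1 (X y) - row ij.2 (X y)) @ ybar -->
        row ij.1 (X ybar) - row ij.2 (X ybar).
      exact: (cvgB (crow ij.1) (crow ij.2)).
    have nz : row ij.1 (X ybar) - row ij.2 (X ybar) != 0.
      by rewrite subr_eq0; apply: contra_neq nij => /injbar.
    near=> y => E; have : row ij.1 (X y) - row ij.2 (X y) != 0.
      by near: y; exact: (cvgr_neq0 _ cB nz).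
    by rewrite E subrr eqxx.
  by apply: filterS (filter_forall _ H) => y Hy i j; exact: (Hy (i, j)).
have sg_near : \forall y \near ybar, forall j,
    Num.sg (beta y 0 j) = Num.sg (beta ybar 0 j).
  exact: filter_forall _ (fun j => near_sg (cbeta j) (hbeta j)).
have int_near : \forall y \near ybar, forall j, interior Omega (row j (X y)).
  exact: filter_forall _ (fun j => crow j _ (nbhs_interior (hint j))).
have diff_near : \forall y \near ybar, forall j,
    differentiable phi (row j (X y)).
  exact: filter_forall _ (fun j => crow j _ (hphi1 j)).
have key : \forall y \near ybar, forall j,
    Phi_adj phi (p y) (row j (X y)) = lam * Num.sg (beta ybar 0 j) /\
    forall a, \sum_i jacobian phi (row j (X y)) a i * p y 0 i = 0.
  near=> y => j.
  have Uy : U y by near: y.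
  have sgy : Num.sg (beta y 0 j) = Num.sg (beta ybar 0 j).
    by move: j; near: y.
  have injy : injective (fun j => row j (X y)) by near: y.
  have b0 : beta y 0 j != 0 by rewrite -sgr_eq0 sgy sgr_eq0.
  have py : Phi_adj phi (p y) (row j (X y)) = lam * Num.sg (beta ybar 0 j).
    by rewrite -sgy; exact: (dual_sign hphi hlam (hX y Uy) (hsol y Uy) injy b0).
  have sq1 : Num.sg (beta ybar 0 j) ^+ 2 = 1 by rewrite sqr_sg hbeta.
  have inty : interior Omega (row j (X y)).
    by move: j {sgy b0 py sq1}; near: y.
  have dphiy : differentiable phi (row j (X y)).
    by move: j {sgy b0 py sq1 inty}; near: y.
  split=> // a; apply: Phi_adj_extremum sq1 _ py inty dphiy.
  exact: (dual_bound hphi hlam (hX y Uy) (hsol y Uy)).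
(* The certificate of the arbitrary solution [m ybar] is that of the discrete one, as both have the
   same image under [Phi]. *)
have QE : Q = fun j => - (lam / beta ybar 0 j) *:
    hessian (Phi_adj phi (lam^-1 *: p ybar)) (row j (X ybar)).
  by rewrite /Q /eta /dual_cert -/(muhat ybar) muE.
have val_near j : \forall y \near ybar,
    Phi_adj phi (p y) (row j (X y)) = lam * Num.sg (beta ybar 0 j).
  by apply: filterS key => y /(_ j)[].
have crit_near j a : \forall y \near ybar,
    \sum_i jacobian phi (row j (X y)) a i * p y 0 i = 0.
  by apply: filterS key => y /(_ j)[_ /(_ a)].
have muhat_d i : is_derive ybar (delta_mx 0 i) (fun y => muhat y 0 i)
    ((G *m invmx M *m G^T) i i).
  apply: (@near_eq_is_derive _ _ _ (fun y => mu y 0 i)).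
    near=> y; have Uy : U y by near: y.
    by have -> := muE y Uy.
  (* A diagonal entry is the [i]-th coordinate of the derivative in the [i]-th basis direction, so
     the divergence is the trace. *)
  have -> : (G *m invmx M *m G^T) i i =
      (G *m invmx M *m G^T *m (delta_mx 0 i : 'rV[R]_n)^T) i 0.
    by rewrite trmx_delta -colE [RHS]mxE.
  rewrite /M QE; apply: (is_derive_mu dbeta dX hphi1 hphi2 hbeta val_near crit_near).
    by rewrite gt_eqF.
  by rewrite -QE.
split; first by move=> i; have [] := muhat_d i.
by apply: eq_bigr => i _; have [_ ->] := muhat_d i.
Unshelve. all: by end_near. Qed.
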